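(* For all integers $k\ge 1$, the following are equivalent for a complete multipartite graph $G$: (a) $G\in\widehat{\mathcal{T}}_k$; (b) $G\in\widehat{\mathcal{P}}_k$; (c) $G=K_{k+2}$, or $k\ge 3$ is odd and $$G=K_{\underbrace{2,\dots,2}_{(k+3)/2}}.$$
   Context: All graphs are undirected, simple, finite and non-empty. A graph $H$ is a minor of $G$ if a graph isomorphic to $H$ can be obtained from $G$ by a sequence of edge contractions, edge deletions and vertex deletions (after a contraction, parallel edges are replaced by a single edge). $\mathcal{T}_k$ is the class of graphs with treewidth at most $k$, and $\mathcal{P}_k$ is the class of graphs with pathwidth at most $k$; both are minor-closed. For a minor-closed class $\mathcal{X}$, $\widehat{\mathcal{X}}$ denotes its set of minimal forbidden minors: the graphs $G\notin\mathcal{X}$ such that every proper minor of $G$ is in $\mathcal{X}$. A graph is complete $c$-partite if its vertices can be $c$-coloured so that two vertices are adjacent if and only if they have distinct colours; it is complete multipartite if it is complete $c$-partite for some $c$. $K_{n_1,\dots,n_c}$ is the complete $c$-partite graph with $n_i$ vertices in the $i$-th colour class; $K_{2,\dots,2}$ above has $(k+3)/2$ classes of size $2$. Equality of graphs means isomorphism. *)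

(* Defs.v *)
From mathcomp Require Import all_boot.
From mathcomp Require Import boolp.

Set Implicit Arguments.
Unset Strict Implicit.
Unset Printing Implicit Defensive.

Record sgraph := SGraph {
  vertex :> finType;
  adj : rel vertex;
  adj_sym : symmetric adj;
  adj_irr : irreflexive adj;
  vertex_gt0 : 0 < #|vertex| }.

Declare Scope sgraph_scope.
Delimit Scope sgraph_scope with sg.
Open Scope sgraph_scope.

Notation "x -- y" := (adj x y) (at level 30, no associativity) : sgraph_scope.

Definition iso (G H : sgraph) : Prop :=
  exists2 f : G -> H, bijective f & forall x y, f x -- f y = x -- y.

Notation "G ≃ H" := (iso G H) (at level 70, no associativity) : sgraph_scope.

(* The three operations are specified up to isomorphism of the result [H].   *)

(* [H] is [G - v]. *)
Definition vertex_deletion (G : sgraph) (v : G) (H : sgraph) : Prop :=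
  exists f : H -> G,
    [/\ injective f,
        forall x, (x \in codom f) = (x != v)
      & forall a b, a -- b = f a -- f b].

(* [H] is [G - uv]. *)
Definition edge_deletion (G : sgraph) (u v : G) (H : sgraph) : Prop :=
  u -- v /\
  exists2 f : H -> G, bijective f &
    forall a b, a -- b = f a -- f b && ([set f a; f b] != [set u; v]).

(* [H] is [G / uv]; [f] is the quotient map, which identifies [u] and [v] and
   nothing else. *)
Definition edge_contraction (G : sgraph) (u v : G) (H : sgraph) : Prop :=
  u -- v /\
  exists f : G -> H,
    [/\ forall a, exists x, f x = a,
        forall x y, f x = f y <-> x = y \/ [set x; y] = [set u; v]
      & forall a b, a -- b <->
          a <> b /\ exists x y, [/\ f x = a, f y = b & x -- y]].

Inductive minor_step (G H : sgraph) : Prop :=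
| StepVertexDeletion v of @vertex_deletion G v H
| StepEdgeDeletion u v of @edge_deletion G u v H
| StepEdgeContraction u v of @edge_contraction G u v H.

Inductive minor (H : sgraph) : sgraph -> Prop :=
| MinorIso G of H ≃ G : minor H G
| MinorStep G G' of minor_step G G' & minor H G' : minor H G.

Definition proper_minor (H G : sgraph) : Prop := minor H G /\ ~ H ≃ G.

Definition minimal_forbidden_minor (X : sgraph -> Prop) (G : sgraph) : Prop :=
  ~ X G /\ forall H, proper_minor H G -> X H.

Definition connected (G : sgraph) : Prop := forall x y : G, connect (@adj G) x y.

(* [ucycle] also accepts the degenerate cycle [:: x; y] along an edge. *)
Definition acyclic (G : sgraph) : Prop :=
  forall c : seq G, ucycle (@adj G) c -> size c <= 2.

Definition is_tree (T : sgraph) : Prop := connected T /\ acyclic T.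

Section PathGraph.
Variable n : nat.

Definition path_adj : rel 'I_n.+1 :=
  fun i j => (i.+1 == j :> nat) || (j.+1 == i :> nat).

Lemma path_adj_sym : symmetric path_adj.
Proof. by move=> i j; rewrite /path_adj orbC. Qed.

Lemma path_adj_irr : irreflexive path_adj.
Proof. by move=> i; rewrite /path_adj orbb -[X in _ == X]addn0 -addn1 eqn_add2l. Qed.

Lemma path_gt0 : 0 < #|'I_n.+1|.
Proof. by rewrite card_ord. Qed.

(* The path with [n.+1] vertices. *)
Definition path_graph : sgraph := SGraph path_adj_sym path_adj_irr path_gt0.

End PathGraph.

Definition is_path (T : sgraph) : Prop := exists n, T ≃ path_graph n.

Record tree_decomposition (G T : sgraph) (B : T -> {set G}) : Prop :=
  TreeDecomposition {
    td_tree : is_tree T;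
    td_vertex : forall v, exists t, v \in B t;
    td_edge : forall u v, u -- v -> exists t, (u \in B t) && (v \in B t);
    (* the nodes whose bag contains [v] induce a connected subgraph of [T] *)
    td_connected : forall v s t, v \in B s -> v \in B t ->
      connect [rel x y | [&& x -- y, v \in B x & v \in B y]] s t }.

Definition path_decomposition (G T : sgraph) (B : T -> {set G}) : Prop :=
  is_path T /\ tree_decomposition B.

(* The bags of a decomposition of a (non-empty) graph are not all empty, so the
   predecessor is not truncated. *)
Definition width (G T : sgraph) (B : T -> {set G}) : nat :=
  (\max_(t : T) #|B t|).-1.

Definition tree_width_attained (G : sgraph) (w : nat) : Prop :=
  exists (T : sgraph) (B : T -> {set G}), tree_decomposition B /\ width B = w.

Definition path_width_attained (G : sgraph) (w : nat) : Prop :=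
  exists (T : sgraph) (B : T -> {set G}), path_decomposition B /\ width B = w.

Lemma trivial_path_decomposition (G : sgraph) :
  path_decomposition (fun _ : path_graph 0 => [set: G]).
Proof.
split; first by exists 0; exists id => //; exists id.
split.
- split=> [x y|c /andP[_ /card_uniqP <-]]; first by rewrite !ord1 connect0.
  by rewrite (leq_trans (max_card _)) // card_ord.
- by move=> v; exists ord0; rewrite inE.
- by move=> u v _; exists ord0; rewrite !inE.
- by move=> v s t _ _; rewrite !ord1 connect0.
Qed.

Lemma path_width_exists (G : sgraph) : exists w, `[< path_width_attained G w >].
Proof.
exists (width (fun _ : path_graph 0 => [set: G])); apply/asboolP.
by do 2!eexists; split; first exact: trivial_path_decomposition.
Qed.

Lemma tree_width_exists (G : sgraph) : exists w, `[< tree_width_attained G w >].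
Proof.
exists (width (fun _ : path_graph 0 => [set: G])); apply/asboolP.
by do 2!eexists; split; first exact: (trivial_path_decomposition G).2.
Qed.

Definition treewidth (G : sgraph) : nat := ex_minn (tree_width_exists G).
Definition pathwidth (G : sgraph) : nat := ex_minn (path_width_exists G).

Definition treewidth_class (k : nat) (G : sgraph) : Prop := treewidth G <= k.
Definition pathwidth_class (k : nat) (G : sgraph) : Prop := pathwidth G <= k.

Definition partite_colouring (c : nat) (G : sgraph) (col : G -> 'I_c) : Prop :=
  forall x y, x -- y = (col x != col y).

Definition complete_multipartite (G : sgraph) : Prop :=
  exists (c : nat) (col : G -> 'I_c), partite_colouring col.

(* [G ≃ K_n] *)
Definition is_complete (n : nat) (G : sgraph) : Prop :=
  #|G| = n /\ forall x y : G, x -- y = (x != y).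

(* [G ≃ K_(n_0, ..., n_(c-1))] *)
Definition is_complete_partite (c : nat) (n : 'I_c -> nat) (G : sgraph) : Prop :=
  exists2 col : G -> 'I_c, partite_colouring col &
    forall i, #|[set x | col x == i]| = n i.

(* Main.v *)
(* If no bag of a tree decomposition contains all vertices, then there are two
   vertices, sharing no bag, each of which has its closed neighbourhood inside a
   single bag: root the tree anywhere and take a vertex [x] whose bags are
   farthest from the root, then root it at the bag around [x] and do the same.
   So a graph of treewidth at most [k] on more than [k.+1] vertices has two
   distinct nonadjacent vertices of degree at most [k].

   Let [G] be complete multipartite on [n] vertices, forbidden and minimal.
   Spreading a colour class over a path of bags shows that every class has at
   most [n - k.+1] vertices, so all degrees are at least [k.+1].  Delete an edge
   [uv]: in a decomposition of width [k], the two vertices above must be [u] and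
   [v], which forces the classes of [u] and [v] to have exactly [n - k.+1]
   elements.  Moreover any two of the other [n - 2] vertices then share a bag, so
   one bag contains them all and [n - 2 <= k.+1].  Hence all the classes have the
   same size, which is 1 or 2; the 4-cycle ([k = 1]) is excluded because it
   contracts to a triangle. *)
Require Import Defs.
From mathcomp Require Import all_boot.
From mathcomp Require boolp.

Set Implicit Arguments.
Unset Strict Implicit.
Unset Printing Implicit Defensive.

(** * Simplicial vertices of tree decompositions *)

(** Adjacency in the graph minus [s]. Keeping [s] as an isolated vertex avoids a change of vertex
    type. *)
Definition adj_avoid (G : sgraph) (s : G) : rel G :=
  fun x y => [&& x -- y, x != s & y != s].

Lemma adj_avoid_sym (G : sgraph) (s : G) : connect_sym (adj_avoid s).
Proof.
apply: sym_connect_sym => x y; rewrite /adj_avoid adj_sym.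
by case: (x != s); case: (y != s).
Qed.

Lemma path_avoid (G : sgraph) (s a : G) (p : seq G) :
  path (@adj G) a p -> s \notin a :: p -> path (adj_avoid s) a p.
Proof.
elim: p a => //= b p IHp a /andP[ab ab_p].
rewrite {1}/adj_avoid ab !inE !negb_or !(eq_sym s) => /and3P[-> bs s_p] /=; rewrite bs /=.
by apply: IHp => //; rewrite inE negb_or (eq_sym s b) bs.
Qed.

(** Otherwise a simple path from [a] to [b] off [s] closes through [s] into a cycle with at least
    three vertices. *)
Lemma acyclic_avoid (T : sgraph) (s a b : T) :
  acyclic T -> s -- a -> s -- b -> connect (adj_avoid s) a b -> a = b.
Proof.
move=> acT sa sb /connectP[p0 /shortenP[p ap p_uniq _] def_b].
have p_adj : path (@adj T) a p by apply: sub_path ap => x y /and3P[].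
have s_notin : s \notin a :: p.
  rewrite inE negb_or.
  have -> : s != a by apply: contraTneq sa => ->; rewrite adj_irr.
  elim: p a {sa p_uniq def_b p_adj} ap => //= c p IHp a /andP[/and3P[_ _ cs] cp].
  by rewrite inE negb_or eq_sym cs /= (IHp c).
have /acT : ucycle (@adj T) (s :: a :: p).
  rewrite /ucycle cons_uniq s_notin p_uniq /= sa rcons_path p_adj /=.
  by rewrite -def_b adj_sym sb.
by case: p {ap p_uniq p_adj s_notin} def_b.
Qed.

(** [d t] is the length of a shortest walk from [r] to [t]; dropping the last step of such a walk
    gives the strictly closer neighbour. *)
Lemma distance_exists (G : sgraph) (r : G) : connected G ->
  exists d : G -> nat, [/\ d r = 0, forall t, d t = 0 -> t = r
    & forall t, t != r -> exists2 t', t' -- t & d t' < d t].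
Proof.
move=> conG.
pose P t n := [exists p : n.-tuple G, path (@adj G) r p && (last r p == t)].
have exP t : exists n, P t n.
  have /connectP[p rp ->] := conG r t.
  by exists (size p); apply/existsP; exists (in_tuple p); rewrite /= rp eqxx.
exists (fun t => ex_minn (exP t)); split.
- case: ex_minnP => m _ /(_ 0) min_m; apply/eqP; rewrite -leqn0; apply: min_m.
  by apply/existsP; exists [tuple]; rewrite /= eqxx.
- move=> t; case: ex_minnP => m + _ m0; rewrite {}m0 => /existsP[p].
  by rewrite (tuple0 p) => /andP[_ /eqP].
move=> t tr; case: (ex_minnP (exP t)) => m /existsP[[p /= /eqP sz_p]].
case/lastP: p sz_p => [_ /andP[_ /eqP rt]|p t' sz_p]; first by rewrite -rt eqxx in tr.
rewrite rcons_path last_rcons => /andP[/andP[rp pt] /eqP def_t] _.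
rewrite {t'}def_t in sz_p pt; exists (last r p) => //.
case: ex_minnP => n _ /(_ (size p)) le_n.
rewrite -sz_p size_rcons ltnS; apply: le_n.
by apply/existsP; exists (in_tuple p); rewrite /= rp eqxx.
Qed.

(** Adjacency, with loops, in the chordal supergraph of [G] obtained by turning every bag into a
    clique. *)
Definition share (G T : sgraph) (B : T -> {set G}) : rel G :=
  fun x y => [exists t, (x \in B t) && (y \in B t)].

Lemma share_sym (G T : sgraph) (B : T -> {set G}) : symmetric (share B).
Proof. by move=> x y; apply: eq_existsb => t; rewrite andbC. Qed.

Section TreeDecomposition.
Variables (G T : sgraph) (B : T -> {set G}).
Hypothesis tdB : tree_decomposition B.

Lemma share_adj x y : x -- y -> share B x y.
Proof. by move/(td_edge tdB)=> [t tP]; apply/existsP; exists t. Qed.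

Lemma share_refl x : share B x x.
Proof. by have [t xt] := td_vertex tdB x; apply/existsP; exists t; rewrite xt. Qed.

(* Were [s] outside the bags of [z], these bags and the walk from [q] to [r]
   would connect, off [s], the neighbour of [s] inside the bags of [y] to the one
   closer to [r], closing a cycle through [s]. *)
Lemma share_far_node (r s : T) (d : T -> nat) (y z : G) (q : T) :
    d r = 0 -> (forall t, d t = 0 -> t = r) ->
    (forall t, t != r -> exists2 t', t' -- t & d t' < d t) ->
    y \in B s -> (forall t, y \in B t -> d s <= d t) ->
    z \in B q -> d q <= d s -> share B z y -> z \in B s.
Proof.
move=> dr0 dr dlt ys min_s zq le_qs /existsP[p /andP[zp yp]].
have [-> //|qs] := eqVneq s q.
apply: contraT => zs.
(* Each step towards [r] strictly decreases [d], so a walk that starts no farther than [s] never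
   meets [s]. *)
have near_r t : d t <= d s -> t != s -> connect (adj_avoid s) t r.
  have [n] := ubnP (d t); elim: n t => // n IHn t; rewrite ltnS => le_tn le_ts ts.
  have [-> //|/dlt[t' t't lt_t]] := eqVneq t r.
  have t's : t' != s by apply: contraTneq lt_t => ->; rewrite -leqNgt.
  apply: (@connect_trans _ _ t'); last first.
    apply: IHn => //; first exact: leq_trans lt_t le_tn.
    exact: leq_trans (ltnW lt_t) le_ts.
  by apply: connect1; rewrite /adj_avoid adj_sym t't ts.
have sr : s != r.
  apply: contraNneq qs => sr; rewrite sr eq_sym; apply/eqP/dr/eqP.
  by rewrite -leqn0 -dr0 -sr.
have [s' s's lt_s] := dlt s sr.
have ps : p != s by apply: contraNneq zs => <-.
have pq : connect (adj_avoid s) p q.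
  apply: connect_sub (td_connected tdB zp zq) => a b /and3P[ab za zb].
  by apply: connect1; rewrite /adj_avoid ab /=; apply/andP; split; apply: contraNneq zs => <-.
have /connectP[l0 /shortenP[l sl l_uniq _] def_p] := td_connected tdB ys yp.
case: l => [|p1 l] in sl l_uniq def_p; first by rewrite def_p eqxx in ps.
move: sl => /= /andP[/and3P[sp1 _ yp1] pl].
have p1p : connect (adj_avoid s) p1 p.
  apply/connectP; exists l; last by [].
  apply: path_avoid; last by case/andP: l_uniq.
  by apply: sub_path pl => a b /and3P[].
have p1s' : p1 = s'.
  apply: (acyclic_avoid (td_tree tdB).2 sp1); first by rewrite adj_sym.
  apply: connect_trans p1p (connect_trans pq _).
  apply: connect_trans (near_r q le_qs _) _; first by rewrite eq_sym.
  rewrite adj_avoid_sym; apply: near_r; first exact: ltnW.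
  by apply: contraTneq lt_s => ->; rewrite ltnn.
by have := min_s _ yp1; rewrite p1s' leqNgt lt_s.
Qed.

(* [y] is a vertex of [S] whose bags lie as far as possible from [r]. *)
Lemma simplicial_off_bag (S : {set G}) (r : T) : S \subset B r \/
  exists y s, [/\ y \in S, y \notin B r & {in S, forall z, share B z y -> z \in B s}].
Proof.
have [d [dr0 dr dlt]] := distance_exists r (td_tree tdB).1.
have /fin_all_exists2[top top_in top_min] x :
    exists2 s, x \in B s & forall t, x \in B t -> d s <= d t.
  have [t0 xt0] := td_vertex tdB x.
  by case: (@arg_minnP _ t0 (fun t => x \in B t) d xt0) => s xs min_s; exists s.
have [->|/set0Pn[x0 x0S]] := eqVneq S set0; first by left; apply: sub0set.
case: (@arg_maxnP _ x0 (mem S) (d \o top) x0S) => y yS max_y.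
(* If the top of [y] is the root, then by maximality every vertex of [S] has its top there. *)
have [top_r|top_r] := eqVneq (top y) r.
  left; apply/subsetP=> z zS; have := max_y z zS.
  by rewrite /= top_r dr0 leqn0 => /eqP/dr <-; apply: top_in.
right; exists y, (top y); split=> // [|z zS zy].
  apply: contraNN top_r => /top_min; rewrite dr0 leqn0 => /eqP d0.
  by rewrite (dr _ d0).
apply: (share_far_node dr0 dr dlt _ _ _ (max_y z zS) zy); first exact: top_in.
  exact: top_min.
exact: top_in.
Qed.

(** The second root is the bag [B s] around the first vertex [x]: it contains all vertices of [S]
    that share a bag with [x], so a vertex [y] outside it shares none. The set [S] is arbitrary
    because the dichotomy is used both for all vertices and for all but two. *)
Lemma bag_or_two_simplicial (S : {set G}) : (exists t, S \subset B t) \/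
  exists x y s t, [/\ x \in S, y \in S, ~~ share B x y,
    {in S, forall z, share B z x -> z \in B s}
    & {in S, forall z, share B z y -> z \in B t}].
Proof.
have /card_gt0P[r0 _] := vertex_gt0 T.
have [?|[x [s [xS _ xP]]]] := simplicial_off_bag S r0; first by left; exists r0.
have [?|[y [t [yS ys yP]]]] := simplicial_off_bag S s; first by left; exists s.
right; exists x, y, s, t; split=> //.
by apply: contraNN ys; rewrite share_sym => /(xP y yS).
Qed.

End TreeDecomposition.

(** * Bounded width and interval representations *)

Lemma width_leq (G T : sgraph) (B : T -> {set G}) (k : nat) :
  width B <= k <-> forall t, #|B t| <= k.+1.
Proof.
rewrite /width -subn1 leq_subLR add1n.
split=> [/bigmax_leqP le_B t|le_B]; first exact: le_B.
by apply/bigmax_leqP => t _; apply: le_B.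
Qed.

Lemma treewidth_classP (k : nat) (G : sgraph) : treewidth_class k G <->
  exists (T : sgraph) (B : T -> {set G}), tree_decomposition B /\ forall t, #|B t| <= k.+1.
Proof.
rewrite /treewidth_class /treewidth; case: ex_minnP => w /boolp.asboolP[T [B [tdB <-]]] min_w.
split=> [/width_leq le_k|[T' [B' [tdB' /width_leq leB]]]]; first by exists T, B.
by apply: (leq_trans _ leB); apply/min_w/boolp.asboolP; exists T', B'.
Qed.

Lemma pathwidth_classP (k : nat) (G : sgraph) : pathwidth_class k G <->
  exists (T : sgraph) (B : T -> {set G}), path_decomposition B /\ forall t, #|B t| <= k.+1.
Proof.
rewrite /pathwidth_class /pathwidth; case: ex_minnP => w /boolp.asboolP[T [B [pdB <-]]] min_w.
split=> [/width_leq le_k|[T' [B' [pdB' /width_leq leB]]]]; first by exists T, B.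
by apply: (leq_trans _ leB); apply/min_w/boolp.asboolP; exists T', B'.
Qed.

Lemma pathwidth_treewidth_class (k : nat) (G : sgraph) :
  pathwidth_class k G -> treewidth_class k G.
Proof.
by move=> /pathwidth_classP[T [B [[_ tdB] leB]]]; apply/treewidth_classP; exists T, B.
Qed.

Lemma connect_path_interval (n : nat) (e : rel 'I_n.+1) (i j : 'I_n.+1) :
  i <= j ->
  (forall a b : 'I_n.+1, i <= a -> b <= j -> a.+1 = b -> e a b) ->
  connect e i j.
Proof.
move=> le_ij eP; have [m] := ubnP (j - i).
elim: m i le_ij eP => // m IHm i le_ij eP lt_m.
have [/val_inj -> //|ne_ij] := eqVneq (val i) (val j).
have lt_ij : i < j by rewrite ltn_neqAle ne_ij.
have lt_i : i.+1 < n.+1 by apply: leq_ltn_trans (ltn_ord j).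
apply: (@connect_trans _ _ (Ordinal lt_i)); first by apply: connect1; apply: eP.
apply: IHm => // [a b /ltnW|]; first exact: eP.
by rewrite subnS prednK ?subn_gt0.
Qed.

(** Rotate a cycle to start at its largest node [m]. If it had three or more nodes, its second and
    last nodes would both be the predecessor of [m], hence equal. *)
Lemma path_graph_tree (n : nat) : is_tree (path_graph n).
Proof.
split=> [x y|c c_cyc].
  wlog le_xy : x y / x <= y.
    move=> Hw; have [|/ltnW] := leqP x y; first exact: Hw.
    by rewrite (sym_connect_sym (@adj_sym _)); apply: Hw.
  by apply: connect_path_interval => // a b _ _ ab; rewrite /= /path_adj ab eqxx.
case: c c_cyc => // x0 c0 c_cyc.
have [m m_c m_max] : exists2 m, m \in x0 :: c0 & forall y, y \in x0 :: c0 -> y <= m.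
  by case: (@arg_maxnP _ x0 (mem (x0 :: c0)) val (mem_head _ _)) => m m_c ?; exists m.
have [i c'] := rot_to m_c => def_c.
rewrite -(size_rot i) def_c.
have : ucycle (@adj (path_graph n)) (m :: c') by rewrite -def_c rot_ucycle.
have {}m_max y : y \in c' -> y <= m.
  by move=> yc; apply: m_max; rewrite -(mem_rot i) def_c inE yc orbT.
case: c' m_max {def_c} => // a p m_max /andP[/= /andP[ma +] /and3P[_ ap _]].
rewrite rcons_path; case/andP=> _ ml.
case: p m_max ml ap => // b p m_max ml ap.
have pred_m y : y \in [:: a, b & p] -> path_adj m y -> y.+1 = m.
  move=> /m_max le_ym /orP[/eqP my|/eqP //].
  by rewrite -my ltnn in le_ym.
have al : a = last b p.
  apply/val_inj/eqP; rewrite -eqSS.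
  rewrite (pred_m a) ?mem_head // (pred_m (last b p)) //.
    by rewrite inE [_ \in _ :: _]mem_last orbT.
  by rewrite /path_adj orbC.
by rewrite al mem_last in ap.
Qed.

(** The bag at [i] collects the vertices whose interval from [l x] to [r x] contains [i]. As
    adjacency is symmetric, the second hypothesis makes the intervals of adjacent vertices meet,
    namely at the larger left end. *)
Lemma interval_pathwidth (k n : nat) (G : sgraph) (l r : G -> nat) :
    (forall x, l x <= r x <= n) ->
    (forall x y, x -- y -> l x <= r y) ->
    (forall i, #|[set x | l x <= i <= r x]| <= k.+1) ->
  pathwidth_class k G.
Proof.
move=> lrn adj_lr bagk; apply/pathwidth_classP.
pose B (i : path_graph n) := [set x | l x <= val i <= r x].
exists (path_graph n), B; split=> [|t]; last exact: bagk.
split; first by exists n; exists id => //; exists id.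
split; first exact: path_graph_tree.
- move=> v; have /andP[lr rn] := lrn v.
  by exists (Ordinal (rn : r v < n.+1)); rewrite inE /= lr leqnn.
- move=> u v uv; have m_lt : maxn (l u) (l v) < n.+1.
    rewrite ltnS geq_max; case/andP: (lrn u) (lrn v) => lu un /andP[lv vn].
    by rewrite (leq_trans lu un) (leq_trans lv vn).
  exists (Ordinal m_lt); rewrite !inE /= leq_maxl leq_maxr !geq_max.
  case/andP: (lrn u) (lrn v) => -> _ /andP[-> _].
  by rewrite !adj_lr // adj_sym.
move=> v s t.
wlog le_st : s t / s <= t.
  move=> Hw vs vt; have [le_st|/ltnW le_ts] := leqP s t; first exact: Hw.
  rewrite sym_connect_sym; first exact: Hw.
  by move=> a b; rewrite /= /path_adj orbC [X in _ && X]andbC.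
rewrite !inE => /andP[ls _] /andP[_ tr].
apply: connect_path_interval => // a b sa bt ab.
have vB (c : path_graph n) : s <= c -> c <= t -> v \in B c.
  by move=> sc ct; rewrite inE (leq_trans ls sc) (leq_trans ct tr).
have lt_ab : a < b by rewrite -ab.
apply/and3P; split; first by rewrite /= /path_adj ab eqxx.
  by apply: vB => //; apply: leq_trans (ltnW lt_ab) bt.
by apply: vB => //; apply: leq_trans sa (ltnW lt_ab).
Qed.

(** * Pathwidth and minors *)

(* [phi] sends a vertex of [G] to the vertex of [H] it is contracted into, and a
   deleted vertex to [None]. *)
Lemma minor_map_pathwidth (k : nat) (G H : sgraph) (phi : G -> option H) :
    (forall a, exists x, phi x = Some a) ->
    (forall x y a, phi x = Some a -> phi y = Some a -> x = y \/ x -- y) ->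
    (forall a b, a -- b -> exists x y, [/\ phi x = Some a, phi y = Some b & x -- y]) ->
  pathwidth_class k G -> pathwidth_class k H.
Proof.
move=> phi_onto phi_conn phi_adj /pathwidth_classP[T [B [[pathT tdB] leB]]].
pose B' t := [set a | Some a \in phi @: B t].
have inB' t x a : x \in B t -> phi x = Some a -> a \in B' t.
  by move=> xt xa; rewrite inE -xa imset_f.
apply/pathwidth_classP; exists T, B'; split=> [|t]; last first.
  rewrite -(card_imset _ Some_inj); apply: leq_trans (leB t).
  apply: leq_trans (leq_imset_card phi _); apply/subset_leq_card/subsetP=> _ /imsetP[a + ->].
  by rewrite inE.
split=> //; split; first exact: td_tree tdB.
- move=> a; have [x xa] := phi_onto a; have [t xt] := td_vertex tdB x.
  by exists t; apply: inB' xa.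
- move=> a b /phi_adj[x [y [xa yb /(td_edge tdB)[t /andP[xt yt]]]]].
  by exists t; rewrite (inB' _ _ _ xt xa) (inB' _ _ _ yt yb).
have same_vertex x a s t : phi x = Some a -> x \in B s -> x \in B t ->
    connect [rel i j | [&& i -- j, a \in B' i & a \in B' j]] s t.
  move=> xa xs xt; apply: connect_sub (td_connected tdB xs xt) => i j /and3P[ij xi xj].
  by apply: connect1; rewrite /= ij (inB' _ _ _ xi xa) (inB' _ _ _ xj xa).
(* Fibres of [phi] are cliques, so the bags of two vertices contracted into [a] have a common node
   [p]. *)
move=> a s t; rewrite !inE => /imsetP[x xs xa] /imsetP[y yt ya].
have [xy|/(td_edge tdB)[p /andP[xp yp]]] := phi_conn x y a (esym xa) (esym ya).
  by apply: (same_vertex x) => //; rewrite xy.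
exact: connect_trans (same_vertex x a s p _ xs xp) (same_vertex y a p t _ yp yt).
Qed.

(** The partial inverse of [f] is a minor map whose fibres are singletons. *)
Lemma subgraph_pathwidth (k : nat) (G H : sgraph) (f : H -> G) :
  injective f -> (forall a b, a -- b -> f a -- f b) ->
  pathwidth_class k G -> pathwidth_class k H.
Proof.
move=> f_inj f_hom; pose phi x := [pick a | f a == x].
have phiP x a : phi x = Some a -> x = f a.
  by rewrite /phi; case: pickP => // b /eqP <- [->].
have phi_f a : phi (f a) = Some a.
  by rewrite /phi; case: pickP => [b /eqP/f_inj -> //|/(_ a)]; rewrite eqxx.
apply: (@minor_map_pathwidth _ _ _ phi) => [a|x y a /phiP-> /phiP->|a b /f_hom ab].
- by exists (f a).
- by left.
by exists (f a), (f b).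
Qed.

Lemma minor_step_pathwidth (k : nat) (G H : sgraph) :
  minor_step G H -> pathwidth_class k G -> pathwidth_class k H.
Proof.
case=> [v [f [f_inj _ fE]]|u v [_ [f /bij_inj f_inj fE]]|u v [uv [f [f_onto fE adjE]]]].
- by apply: subgraph_pathwidth f_inj _ => a b; rewrite fE.
- by apply: subgraph_pathwidth f_inj _ => a b; rewrite fE => /andP[].
(* A contraction deletes no vertex, and its only fibre with two elements is the edge [uv]. *)
apply: (@minor_map_pathwidth _ _ _ (Some \o f)) => [a|x y a [<-] /= [/esym/fE]|a b].
- by have [x <-] := f_onto a; exists x.
- case=> [|xy]; first by left.
  have [|ne_xy] := eqVneq x y; [by left | right].
  have /set2P[xu|xv] : x \in [set u; v] by rewrite -xy set21.
    have : y \in [set u; v] by rewrite -xy set22.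
    by rewrite xu in ne_xy *; rewrite !inE eq_sym (negPf ne_xy) => /eqP->.
  have : y \in [set u; v] by rewrite -xy set22.
  by rewrite xv in ne_xy *; rewrite !inE (eq_sym y v) (negPf ne_xy) orbF adj_sym => /eqP->.
by case/adjE=> _ [x [y [<- <- xy]]]; exists x, y.
Qed.

Lemma minor_pathwidth (k : nat) (G H : sgraph) :
  minor H G -> pathwidth_class k G -> pathwidth_class k H.
Proof.
elim=> {G} [G [f /bij_inj f_inj fE]|G G' GG' _ IH] pwG.
  by apply: subgraph_pathwidth f_inj _ pwG => a b; rewrite fE.
exact/IH/(minor_step_pathwidth GG').
Qed.

(** A derivation of a minor not isomorphic to [G] has a first step, and pathwidth does not grow
    afterwards. *)
Lemma proper_minor_pathwidth (k : nat) (G H : sgraph) :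
  (forall G', minor_step G G' -> pathwidth_class k G') ->
  proper_minor H G -> pathwidth_class k H.
Proof.
move=> stepG [HG nHG]; case: HG nHG stepG => [//|{}G G' GG' HG' _ stepG].
exact: minor_pathwidth HG' (stepG _ GG').
Qed.

Lemma minor_step_proper (G H : sgraph) :
  minor_step G H -> ~ H ≃ G -> proper_minor H G.
Proof.
move=> GH nHG; split=> //; apply: MinorStep GH _; apply: MinorIso.
by exists id => //; exists id.
Qed.

Lemma vertex_deletion_card (G H : sgraph) (v : G) : vertex_deletion v H -> #|H| < #|G|.
Proof.
case=> f [f_inj f_codom _]; rewrite -(card_codom f_inj) (eq_card f_codom).
by rewrite cardC1 prednK //; apply: vertex_gt0.
Qed.

Lemma edge_contraction_card (G H : sgraph) (u v : G) :
  edge_contraction u v H -> #|H| < #|G|.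
Proof.
case=> uv [f [f_onto fE _]].
have ne_uv : u != v by apply: contraTneq uv => ->; rewrite adj_irr.
apply: (@leq_ltn_trans #|f @: [set~ v]|).
  apply/subset_leq_card/subsetP=> a _; have [x <-] := f_onto a.
  have [->|xv] := eqVneq x v; last by rewrite imset_f // !inE.
  have <- : f u = f v by apply/fE; right.
  by rewrite imset_f // !inE.
apply: leq_ltn_trans (leq_imset_card _ _) _.
by rewrite cardsC1 prednK //; apply: vertex_gt0.
Qed.

(** * Bounds on pathwidth and treewidth *)

Lemma independent_pathwidth (k : nat) (G : sgraph) (I : {set G}) :
  I != set0 -> {in I &, forall x y, ~~ x -- y} -> #|G| <= k + #|I| ->
  pathwidth_class k G.
Proof.
rewrite -card_gt0 => I_gt0 indI leG.
(* Each vertex of [I] occupies one node, its index in [enum I], and every other vertex occupies the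
   whole path, so a bag has at most [#|G| - #|I| + 1] vertices. *)
pose l x := if x \in I then index x (enum I) else 0.
pose r x := if x \in I then index x (enum I) else #|I|.-1.
apply: (@interval_pathwidth k #|I|.-1 G l r) => [x|x y xy|i].
- rewrite /l /r; case: ifP => xI; rewrite leqnn //= -ltnS prednK //.
  by rewrite cardE index_mem mem_enum.
- rewrite /l /r; case: ifP => // xI; case: ifP => [yI|_].
    by rewrite (negPf (indI x y xI yI)) in xy.
  by rewrite -ltnS prednK // cardE index_mem mem_enum.
pose J := [set x in I | index x (enum I) == i].
apply: (@leq_trans #|J :|: ~: I|).
  apply/subset_leq_card/subsetP=> x; rewrite !inE /l /r.
  by case: (x \in I) => //=; rewrite orbF -eqn_leq.
apply: leq_trans (leq_card_setU _ _) _.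
have J1 : #|J| <= 1.
  apply/card_le1_eqP=> x y; rewrite !inE => /andP[xI /eqP <-] /andP[yI /eqP].
  by move=> yx; apply: (index_inj x _ _ yx); rewrite mem_enum.
by rewrite -add1n leq_add // -(leq_add2l #|I|) cardsC addnC.
Qed.

Lemma card_pathwidth (k : nat) (G : sgraph) : #|G| <= k.+1 -> pathwidth_class k G.
Proof.
have /card_gt0P[x _] := vertex_gt0 G.
move=> leG; apply: (@independent_pathwidth _ _ [set x]); rewrite ?cards1 ?addn1 //.
  by apply/set0Pn; exists x; rewrite set11.
by move=> y z /set1P-> /set1P->; rewrite adj_irr.
Qed.

Lemma nonadjacent_pathwidth (k : nat) (G : sgraph) (x y : G) :
  x != y -> ~~ x -- y -> #|G| <= k.+2 -> pathwidth_class k G.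
Proof.
move=> ne_xy nxy leG.
apply: (@independent_pathwidth _ _ [set x; y]); rewrite ?cards2 ?ne_xy ?addn2 //.
  by apply/set0Pn; exists x; rewrite set21.
by move=> a b /set2P[]-> /set2P[]->; rewrite ?adj_irr // adj_sym.
Qed.

Definition closed_neighbours (G : sgraph) (x : G) : {set G} := [set z | (z == x) || z -- x].

(** In width at most [k], some bag would contain either all vertices or the closed neighbourhood of
    a vertex [x] that has a nonneighbour [y]; both sets are too large. *)
Lemma treewidth_gt (k : nat) (G : sgraph) : k.+1 < #|G| ->
  (forall x y : G, x != y -> ~~ x -- y -> k.+1 < #|closed_neighbours x|) ->
  ~ treewidth_class k G.
Proof.
move=> ltG degG /treewidth_classP[T [B [tdB leB]]].
have [[t Bt]|[x [y [s [_ [_ _ nxy xP _]]]]]] := bag_or_two_simplicial tdB setT.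
  by rewrite -cardsT ltnNge (leq_trans (subset_leq_card Bt) (leB t)) in ltG.
have ne_xy : x != y by apply: contraNneq nxy => <-; apply: share_refl tdB _.
have nadj_xy : ~~ x -- y by apply: contraNN nxy; apply: share_adj tdB _ _.
have Nx : closed_neighbours x \subset B s.
  apply/subsetP=> z; rewrite inE => /orP[/eqP->|zx]; apply: xP => //.
    exact: share_refl tdB _.
  exact: share_adj tdB _ _ zx.
have := degG x y ne_xy nadj_xy.
by rewrite ltnNge (leq_trans (subset_leq_card Nx) (leB s)).
Qed.

(** * Edge deletion in complete multipartite graphs *)

Section DeleteEdge.
Variables (G : sgraph) (u v : G).

Definition del_adj : rel G := fun x y => x -- y && ([set x; y] != [set u; v]).

Lemma del_adj_sym : symmetric del_adj.
Proof. by move=> x y; rewrite /del_adj adj_sym setUC. Qed.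

Lemma del_adj_irr : irreflexive del_adj.
Proof. by move=> x; rewrite /del_adj adj_irr. Qed.

Definition del_edge : sgraph := SGraph del_adj_sym del_adj_irr (vertex_gt0 G).

Lemma del_edge_adj (x y : G) : (x \notin [set u; v]) || (y \notin [set u; v]) ->
  @adj del_edge x y = x -- y.
Proof.
move=> xy_out; rewrite /= /del_adj; case: (x -- y) => //=.
by apply: contraTneq xy_out => <-; rewrite set21 set22.
Qed.

(** An isomorphism would preserve the number of ordered adjacent pairs, which the deletion
    lowers. *)
Lemma del_edge_proper : u -- v -> proper_minor del_edge G.
Proof.
move=> uv; apply: minor_step_proper.
  by apply: (@StepEdgeDeletion _ _ u v); split=> //; exists id => //; exists id.
case=> f f_bij fE; have [g fK gK] := f_bij.
pose E (H : sgraph) := [set p : H * H | p.1 -- p.2].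
pose F (p : G * G) := (f p.1, f p.2).
have subE : E G \subset F @: E del_edge.
  apply/subsetP=> -[x y]; rewrite inE /= => xy.
  apply/imsetP; exists (g x, g y); last by rewrite /F /= !gK.
  by rewrite inE -fE !gK.
have : E del_edge \proper E G.
  apply/properP; split; first by apply/subsetP=> p; rewrite !inE => /andP[].
  by exists (u, v); rewrite !inE //= /del_adj eqxx andbF.
move/proper_card; rewrite ltnNge => /negP[].
exact: leq_trans (subset_leq_card subE) (leq_imset_card _ _).
Qed.

End DeleteEdge.

(** It contains [x] itself; in a complete multipartite graph it is the colour class of [x],
    described without the colouring. *)
Definition nonneighbours (G : sgraph) (x : G) : {set G} := [set y | ~~ x -- y].

Section Multipartite.
Variables (G : sgraph) (c : nat) (col : G -> 'I_c).
Hypothesis colP : partite_colouring col.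

Lemma nonneighboursE (x : G) : nonneighbours x = [set y | col y == col x].
Proof. by apply/setP=> y; rewrite !inE colP negbK eq_sym. Qed.

Lemma nonneighbours_pathwidth (k : nat) (x : G) :
  #|G| <= k + #|nonneighbours x| -> pathwidth_class k G.
Proof.
apply: independent_pathwidth; first by apply/set0Pn; exists x; rewrite inE adj_irr.
by move=> y z; rewrite nonneighboursE !inE colP => /eqP-> /eqP->; rewrite eqxx.
Qed.

Lemma del_edge_rigid (k : nat) (u v : G) : u -- v ->
    (forall x : G, k + #|nonneighbours x| < #|G|) ->
    treewidth_class k (del_edge u v) ->
  [/\ #|G| = #|nonneighbours u| + k.+1, #|G| = #|nonneighbours v| + k.+1
    & #|G| <= k.+3].
Proof.
move=> uv clsk /treewidth_classP[T [B [tdB leB]]].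
have ne_uv : u != v by apply: contraTneq uv => ->; rewrite adj_irr.
have k_lt : k.+1 < #|G|.
  apply: leq_ltn_trans (clsk u); rewrite -addn1 leq_add2l card_gt0.
  by apply/set0Pn; exists u; rewrite inE adj_irr.
have card_nbr (x : G) : #|~: nonneighbours x| = #|G| - #|nonneighbours x|.
  by rewrite -(cardsC (nonneighbours x)) addKn.
have nbr_gt (x : G) : k < #|~: nonneighbours x|.
  by rewrite card_nbr ltn_subRL addnC.
have nbhd_bag (x : G) (s : T) :
    {in [set: G], forall z, share B z x -> z \in B s} ->
    @closed_neighbours (del_edge u v) x \subset B s.
  move=> xs; apply/subsetP=> z; rewrite inE => /orP[/eqP->|zx]; apply: xs; rewrite ?inE //.
    exact: share_refl tdB _.
  exact: share_adj tdB _ _ zx.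
(* A vertex other than [u] and [v] keeps its at least [k.+1] neighbours, so its closed neighbourhood
   overflows every bag. *)
have simpl_uv (x : G) (s : T) : @closed_neighbours (del_edge u v) x \subset B s ->
    x \in [set u; v].
  move=> Ns; apply: contraLR (leB s) => x_out; rewrite -ltnNge.
  apply: leq_trans (subset_leq_card Ns).
  apply: (@leq_trans #|x |: ~: nonneighbours x|).
    by rewrite cardsU1 !inE adj_irr /= ltnS.
  apply/subset_leq_card/subsetP=> z; rewrite !inE negbK => /orP[->//|xz].
  by rewrite del_edge_adj ?x_out ?orbT // adj_sym xz orbT.
(* An end of the deleted edge loses one neighbour; for the rest to fit in a bag, its degree in [G]
   must be exactly [k.+1]. *)
have simpl_card (x y : G) (s : T) : x -- y -> [set x; y] = [set u; v] ->
    @closed_neighbours (del_edge u v) x \subset B s ->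
    #|G| = #|nonneighbours x| + k.+1.
  move=> xy xy_uv Ns.
  have ne_yx : y != x by apply: contraTneq xy => ->; rewrite adj_irr.
  have sub_s : x |: (~: nonneighbours x :\ y) \subset B s.
    apply: subset_trans Ns; apply/subsetP=> z; rewrite !inE negbK.
    case: (eqVneq z x) => // ne_zx /andP[ne_zy xz].
    rewrite del_edge_adj 1?adj_sym ?xz ?orbT //.
    by rewrite -xy_uv !inE negb_or ne_zx ne_zy.
  have := leq_trans (subset_leq_card sub_s) (leB s).
  rewrite cardsU1 !inE adj_irr andbF /= add1n ltnS => le_k.
  have := cardsD1 y (~: nonneighbours x); rewrite !inE negbK xy add1n => card_eq.
  have : #|~: nonneighbours x| = k.+1.
    by apply/eqP; rewrite eqn_leq nbr_gt andbT card_eq ltnS.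
  by rewrite -(cardsC (nonneighbours x)) => ->.
have [[t Bt]|[x [y [s [t [_ _ nxy xs yt]]]]]] := bag_or_two_simplicial tdB [set: G].
  by rewrite -cardsT ltnNge (leq_trans (subset_leq_card Bt) (leB t)) in k_lt.
have {xs}Nx := nbhd_bag x s xs; have {yt}Ny := nbhd_bag y t yt.
have ne_xy : x != y by apply: contraNneq nxy => <-; apply: share_refl tdB _.
have {nxy}[s0 [t0 [Nu Nv]]] : exists s t,
    @closed_neighbours (del_edge u v) u \subset B s /\
    @closed_neighbours (del_edge u v) v \subset B t.
  move: (simpl_uv x s Nx) (simpl_uv y t Ny) ne_xy (Nx) (Ny).
  rewrite !inE => /orP[]/eqP-> /orP[]/eqP->; rewrite ?eqxx // => _ N1 N2.
    by exists s, t.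
  by exists t, s.
have uv_card := simpl_card u v s0 uv erefl Nu.
have vu_card := simpl_card v u t0 (etrans (adj_sym v u) uv) (setUC _ _) Nv.
(* Two of the other vertices always share a bag: if nonadjacent, they lie in one class, which
   differs from that of [u] or of [v], so both lie in the bag around that end. Hence one bag
   contains all [#|G| - 2] of them. *)
split=> //; have [[r Sr]|] := bag_or_two_simplicial tdB (~: [set u; v] : {set G}).
  have := leq_trans (subset_leq_card Sr) (leB r).
  by rewrite -(cardsC [set u; v]) cards2 ne_uv !addSn add0n !ltnS.
case=> {ne_xy Nx Ny s t}x [{}y [_ [_ [x_out y_out nxy _ _]]]]; case/negP: nxy.
have share_bag r : x \in B r -> y \in B r -> share B x y.
  by move=> xr yr; apply/existsP; exists r; rewrite xr yr.
have [xy|nxy] := boolP (@adj G x y).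
  apply: (share_adj tdB); rewrite del_edge_adj //.
  by move: x_out; rewrite in_setC => ->.
have same_col : col x = col y by move: nxy; rewrite colP negbK => /eqP.
have out_bag (z w : G) (r : T) : @closed_neighbours (del_edge u v) w \subset B r ->
    z \in ~: [set u; v] -> z -- w -> z \in B r.
  move=> /subsetP Nw z_out zw; apply: Nw; rewrite inE del_edge_adj ?zw ?orbT //.
  by move: z_out; rewrite in_setC => ->.
have [xu|nxu] := boolP (@adj G x u).
  apply: (share_bag s0); apply: (out_bag _ u) => //.
  by rewrite colP -same_col -colP.
have xv : @adj G x v.
  by move: nxu uv; rewrite !colP negbK => /eqP->.
apply: (share_bag t0); apply: (out_bag _ v) => //.
by rewrite colP -same_col -colP.
Qed.

Lemma uniform_complete_partite (a : nat) :
  (forall x : G, #|nonneighbours x| = a) ->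
  exists2 m, m * a = #|G| & is_complete_partite (fun _ : 'I_m => a) G.
Proof.
move=> cls_a; pose D := [set col x | x : G].
have colD x : col x \in D by apply: imset_f.
exists #|D|.
  rewrite -[RHS]sum1_card (partition_big col (mem D)) //= -sum_nat_const.
  apply: eq_bigr => _ /imsetP[x _ ->]; rewrite -(cls_a x) nonneighboursE -sum1_card.
  by apply: eq_bigl => y; rewrite inE.
have /card_gt0P[x0 _] := vertex_gt0 G.
pose rank x := enum_rank_in (colD x0) (col x).
have rank_eq x y : (rank x == rank y) = (col x == col y).
  by apply/eqP/eqP => [/(enum_rank_in_inj (colD x) (colD y)) //|]; rewrite /rank => ->.
exists rank => [x y|i]; first by rewrite rank_eq colP.
have /imsetP[x _ def_i] := enum_valP i.
have -> : i = rank x by rewrite /rank -def_i enum_valK_in.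
rewrite -(cls_a x) nonneighboursE; congr #|pred_of_set _|.
by apply/setP=> y; rewrite !inE rank_eq.
Qed.

End Multipartite.

(** * Complete graphs and the contracted 4-cycle *)

Section CompleteGraph.
Variable V : finType.
Hypothesis V_gt0 : 0 < #|V|.

Definition complete_adj : rel V := fun x y => x != y.

Lemma complete_adj_sym : symmetric complete_adj.
Proof. by move=> x y; rewrite /complete_adj eq_sym. Qed.

Lemma complete_adj_irr : irreflexive complete_adj.
Proof. by move=> x; rewrite /complete_adj eqxx. Qed.

Definition complete_graph : sgraph := SGraph complete_adj_sym complete_adj_irr V_gt0.

Lemma complete_graph_treewidth (k : nat) : k.+1 < #|V| -> ~ treewidth_class k complete_graph.
Proof. by move=> ltV; apply: treewidth_gt => // x y ne_xy /negP[]. Qed.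

End CompleteGraph.

Lemma four_cycle_minor (G : sgraph) (c : nat) (col : G -> 'I_c) :
  partite_colouring col -> #|G| = 4 -> (forall x : G, #|nonneighbours x| = 2) ->
  exists2 H, proper_minor H G & ~ treewidth_class 1 H.
Proof.
move=> colP G4 cls2.
have nbr2 (x : G) : #|~: nonneighbours x| = 2.
  by apply/eqP; rewrite -(eqn_add2l #|nonneighbours x|) cardsC G4 cls2.
have /card_gt0P[u _] := vertex_gt0 G.
have /card_gt0P[v] : 0 < #|~: nonneighbours u| by rewrite nbr2.
rewrite !inE negbK => uv.
have ne_uv : u != v by apply: contraTneq uv => ->; rewrite adj_irr.
pose V := {x : G | x != v}.
have cardV : #|{: V}| = 3.
  by rewrite card_sig -[3]/(4.-1) -G4 -(cardC1 v); apply: eq_card => x; rewrite !inE.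
have V_gt0 : 0 < #|{: V}| by rewrite cardV.
exists (complete_graph V_gt0); last by apply: complete_graph_treewidth; rewrite cardV.
apply: minor_step_proper; last first.
  by case=> f /bij_eq_card; rewrite cardV G4.
(* The default value makes [f] send [v] to [u] and fix every other vertex, so it is the quotient map
   of the contraction. *)
pose f x : V := insubd (exist _ u ne_uv : V) x.
have f_val x : val (f x) = if x == v then u else x.
  by rewrite val_insubd; case: (x == v).
have f_sub (a : V) : f (val a) = a by apply: valKd.
have fE x y : (f x == f y) = (x == y) || ([set x; y] == [set u; v]).
  rewrite -val_eqE !f_val; apply/idP/idP.
    have [->|] := eqVneq x v; have [->|] := eqVneq y v; rewrite ?eqxx //.
    - by move=> _ /eqP<-; rewrite setUC eqxx orbT.
    - by move=> _ /eqP->; rewrite eqxx orbT.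
    - by move=> _ _ ->.
  case/orP=> [/eqP->|/eqP xy]; first by rewrite eqxx.
  have : x \in [set u; v] by rewrite -xy set21.
  have : y \in [set u; v] by rewrite -xy set22.
  by rewrite !inE => /orP[]/eqP-> /orP[]/eqP->; rewrite ?eqxx ?(negPf ne_uv).
apply: (@StepEdgeContraction _ _ u v); split=> //; exists f; split=> [a|x y|a b].
- by exists (val a).
- split=> [/eqP|xy]; last by apply/eqP; rewrite fE; case: xy => ->; rewrite eqxx ?orbT.
  by rewrite fE => /orP[]/eqP; [left | right].
split=> [ne_ab|[ne_ab _]]; last by apply/eqP.
split; first by apply/eqP.
have {}ne_ab : val a != val b by rewrite val_eqE.
have [ab|nab] := boolP (val a -- val b); first by exists (val a), (val b).
have fv : f v = f u by apply/eqP; rewrite fE setUC eqxx orbT.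
have col_ab : col (val a) = col (val b) by move: nab; rewrite colP negbK => /eqP.
(* If one of the two nonadjacent vertices is [u], the other is adjacent to [v], which is merged with
   [u]. *)
have [au|au] := eqVneq (val a) u.
  exists v, (val b); split=> //; first by rewrite fv -au f_sub.
  by rewrite colP -col_ab au -colP adj_sym.
have [bu|bu] := eqVneq (val b) u.
  exists (val a), v; split=> //; first by rewrite fv -bu f_sub.
  by rewrite colP col_ab bu -colP.
(* Otherwise the two form a class, and [u] is adjacent to both and to [v], although its degree is
   2. *)
have cls_ab : nonneighbours (val a) = [set val a; val b].
  apply/esym/eqP; rewrite eqEcard cls2 cards2 ne_ab andbT.
  by apply/subsetP=> x /set2P[]->; rewrite inE ?adj_irr.
have au_adj : val a -- u.
  apply: contraT => nau; have : u \in nonneighbours (val a) by rewrite inE.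
  by rewrite cls_ab !inE !(eq_sym u) (negPf au) (negPf bu).
have : v |: [set val a; val b] \subset ~: nonneighbours u.
  apply/subsetP=> x; rewrite !inE negbK => /or3P[]/eqP-> //; rewrite adj_sym //.
  by rewrite colP -col_ab -colP.
move/subset_leq_card; rewrite nbr2 cardsU1 cards2 ne_ab !inE negb_or !(eq_sym v).
by rewrite (valP a) (valP b).
Qed.

(** The hypotheses combine the weaker halves of the two notions of minimality, so the lemma serves
    both. *)
Lemma minimal_multipartite (k c : nat) (G : sgraph) (col : G -> 'I_c) :
    0 < k -> partite_colouring col -> ~ pathwidth_class k G ->
    (forall H, proper_minor H G -> treewidth_class k H) ->
  is_complete (k + 2) G \/
  [/\ 3 <= k, odd k & is_complete_partite (fun _ : 'I_((k + 3) %/ 2) => 2) G].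
Proof.
move=> k_gt0 colP pwG twH.
have cls_lt (x : G) : k + #|nonneighbours x| < #|G|.
  by rewrite ltnNge; apply/negP=> leG; apply: pwG (nonneighbours_pathwidth colP leG).
have cls_gt0 (x : G) : 0 < #|nonneighbours x|.
  by apply/card_gt0P; exists x; rewrite inE adj_irr.
have [G_le cls_card] : #|G| <= k.+3 /\ forall x : G, #|G| = #|nonneighbours x| + k.+1.
  have rigid (x : G) : #|G| = #|nonneighbours x| + k.+1 /\ #|G| <= k.+3.
    have /card_gt0P[y] : 0 < #|~: nonneighbours x|.
      rewrite -(ltn_add2l #|nonneighbours x|) cardsC addn0.
      exact: leq_ltn_trans (leq_addl k _) (cls_lt x).
    rewrite !inE negbK => xy.
    by have [] := del_edge_rigid colP xy cls_lt (twH _ (del_edge_proper xy)).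
  have /card_gt0P[x0 _] := vertex_gt0 G.
  by split=> [|x]; [have [] := rigid x0 | have [] := rigid x].
(* All classes have [#|G| - k.+1] elements: one if [#|G| = k.+2], two if [#|G| = k.+3]. *)
have [G2|G_ne2] := eqVneq #|G| k.+2.
  left; split=> [|x y]; first by rewrite G2 addn2.
  have /cards1P[z cls_x] : #|nonneighbours x| == 1.
    by rewrite -(eqn_add2r k.+1) -cls_card G2.
  have xz : x = z by apply/set1P; rewrite -cls_x inE adj_irr.
  by have := in_set1 y z; rewrite -cls_x inE xz eq_sym => /negbRL.
have G3 : #|G| = k.+3.
  apply/eqP; rewrite eqn_leq G_le ltn_neqAle eq_sym G_ne2.
  have /card_gt0P[x _] := vertex_gt0 G.
  by rewrite (cls_card x) -addn1 addnC leq_add2r cls_gt0.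
have cls2 (x : G) : #|nonneighbours x| = 2.
  by apply/eqP; rewrite -(eqn_add2r k.+1) -cls_card G3.
have [m m2 Gm] := uniform_complete_partite colP cls2.
rewrite G3 -addn3 in m2.
have k_odd : odd k by have := congr1 odd m2; rewrite oddM andbF oddD addbT => /esym/negbFE.
right; split=> //; last by rewrite -m2 mulnK.
(* Below 3 only [k = 1] is odd; then [G] is the 4-cycle. *)
case: k k_gt0 k_odd {pwG cls_lt G_le cls_card G_ne2 m2} G3 twH => [|[|[|]]] // _ _ G4 tw1.
by have [H /tw1] := four_cycle_minor colP G4 cls2.
Qed.

(** * Minimality of the two families *)

(** Deleting a vertex or contracting an edge leaves [k.+1] vertices or fewer; deleting an edge
    leaves [k.+2] with a nonadjacent pair. The conclusion gives the stronger half of each notion of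
    minimality. *)
Lemma complete_minimal (k : nat) (G : sgraph) : is_complete (k + 2) G ->
  ~ treewidth_class k G /\ forall H, proper_minor H G -> pathwidth_class k H.
Proof.
rewrite addn2 => -[Gk adjE]; split.
  by apply: treewidth_gt => [|x y ne_xy]; rewrite ?Gk // adjE ne_xy.
move=> H; apply: proper_minor_pathwidth => {}H [v vH|u v [uv [f f_bij fE]]|u v uvH].
- by apply: card_pathwidth; rewrite -ltnS -Gk; apply: vertex_deletion_card vH.
- have ne_uv : u != v by rewrite -adjE.
  have [g fK gK] := f_bij.
  apply: (@nonadjacent_pathwidth _ _ (g u) (g v)); last by rewrite (bij_eq_card f_bij) Gk.
    by rewrite (can_eq gK).
  by rewrite fE !gK eqxx andbF.
by apply: card_pathwidth; rewrite -ltnS -Gk; apply: edge_contraction_card uvH.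
Qed.

(** * Complete multipartite graphs with all classes of size 2 *)

Section CocktailParty.
Variables (k c : nat) (G : sgraph) (col : G -> 'I_c).
Hypothesis colP : partite_colouring col.
Hypothesis Gk : #|G| = k.+3.
Hypothesis cls2 : forall x : G, #|nonneighbours x| = 2.

Lemma cocktail_mate (x : G) : exists2 x', x' != x & nonneighbours x = [set x; x'].
Proof.
have xx : x \in nonneighbours x by rewrite inE adj_irr.
have /cards1P[x' cls_x] : #|nonneighbours x :\ x| == 1.
  by have /eqP := cardsD1 x (nonneighbours x); rewrite xx cls2 add1n eqSS eq_sym.
exists x'; last by rewrite -(setD1K xx) cls_x.
by have := set11 x'; rewrite -cls_x in_setD1 => /andP[].
Qed.

(** Each vertex misses only its mate, so its closed neighbourhood has [k.+2] vertices. *)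
Lemma cocktail_not_treewidth : ~ treewidth_class k G.
Proof.
apply: treewidth_gt => [|x y ne_xy nxy]; first by rewrite Gk.
apply: (@leq_trans #|[set~ y]|); first by rewrite cardsC1 Gk.
apply/subset_leq_card/subsetP=> z; rewrite !inE => ne_zy.
rewrite -implyNb; apply/implyP=> ne_zx; rewrite adj_sym.
apply: contraT => nxz; have : [set x; y; z] \subset nonneighbours x.
  by apply/subsetP=> w; rewrite !inE => /orP[/orP[]|]/eqP->; rewrite ?adj_irr.
move/subset_leq_card; rewrite cls2 setUC cardsU1 cards2 ne_xy !inE.
by rewrite (negPf ne_zx) (negPf ne_zy).
Qed.

(* The complement of [del_edge u v] contains the path [u' u v v'], whose
   complement is the path [u v' u' v]: three consecutive bags, one for each edge
   of the latter path. *)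
Lemma cocktail_del_edge_pathwidth (u v : G) : u -- v -> pathwidth_class k (del_edge u v).
Proof.
move=> uv; have ne_uv : u != v by apply: contraTneq uv => ->; rewrite adj_irr.
have [u' ne_u' cls_u] := cocktail_mate u; have [v' ne_v' cls_v] := cocktail_mate v.
have nuu' : ~~ u -- u' by have := set22 u u'; rewrite -cls_u inE.
have nvv' : ~~ v -- v' by have := set22 v v'; rewrite -cls_v inE.
have ne_u'v : u' != v by apply: contraTneq uv => <-.
have ne_v'u : v' != u by apply: contraTneq uv => <-; rewrite adj_sym.
have ne_u'v' : u' != v'.
  by apply: contraTneq uv => uv'; move: nuu' nvv'; rewrite uv' !colP !negbK => /eqP-> /eqP->.
(* The intervals are [[0,0]] for [u], [[0,1]] for [v'], [[1,2]] for [u'], [[2,2]] for [v], and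
   [[0,2]] for the rest; each bag misses two of the four special vertices. *)
pose l x := if x == v then 2 else if x == u' then 1 else 0.
pose r x := if x == u then 0 else if x == v' then 1 else 2.
apply: (@interval_pathwidth k 2 (del_edge u v) l r) => [x|x y|i].
- rewrite /l /r; have [->|_] := eqVneq x u.
    by rewrite (negPf ne_uv) eq_sym (negPf ne_u').
  have [->|_] := eqVneq x v; first by rewrite eq_sym (negPf ne_v').
  have [->|_] := eqVneq x u'; first by rewrite (negPf ne_u'v').
  by case: eqP.
- rewrite /= /del_adj => /andP[xy]; rewrite /l /r.
  have [x_v|_] := eqVneq x v.
    have [->|_] := eqVneq y u; first by rewrite x_v setUC eqxx.
    by have [y_v'|//] := eqVneq y v'; rewrite x_v y_v' (negPf nvv') in xy.
  have [x_u'|//] := eqVneq x u'; have [y_u|_] := eqVneq y u; last by case: ifP.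
  by rewrite x_u' y_u adj_sym (negPf nuu') in xy.
have miss (p q : G) : p != q -> ~~ (l p <= i <= r p) -> ~~ (l q <= i <= r q) ->
    #|[set x | l x <= i <= r x]| <= k.+1.
  move=> ne_pq np nq; apply: (@leq_trans #|~: [set p; q]|).
    apply/subset_leq_card/subsetP=> x; rewrite !inE negb_or => xi.
    by apply/andP; split; apply: contraTneq xi => ->.
  by rewrite -(leq_add2l #|[set p; q]|) cardsC cards2 ne_pq Gk.
case: i miss => [|[|[|i]]] miss.
- by apply: (miss u' v) => //; rewrite /l eqxx // (negPf ne_u'v).
- apply: (miss u v) => //; first by rewrite /r eqxx andbF.
  by rewrite /l eqxx.
- apply: (miss u v') => //; first by rewrite eq_sym.
    by rewrite /r eqxx andbF.
  by rewrite /r eqxx (negPf ne_v'u) andbF.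
apply: (miss u v) => //; first by rewrite /r eqxx andbF.
by rewrite /r; case: ifP => _; [|case: ifP => _]; rewrite andbF.
Qed.

(** After a vertex deletion or a contraction at most [k.+2] vertices remain, so it is enough that
    some nonadjacent pair [w], [w'] survives. *)
Lemma cocktail_minor_step (H : sgraph) : 3 <= k -> minor_step G H -> pathwidth_class k H.
Proof.
move=> k_ge3; case=> [v vH|u v [uv [f f_bij fE]]|u v uvH].
- have H_lt := vertex_deletion_card vH; rewrite Gk ltnS in H_lt.
  case: vH => f [f_inj f_codom fE].
  have [w] : exists w, w \in ~: nonneighbours v.
    apply/card_gt0P; rewrite -(ltn_add2l #|nonneighbours v|) cardsC cls2.
    by rewrite Gk addn0.
  have [w' ne_w' cls_w] := cocktail_mate w.
  rewrite !inE negbK => vw.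
  have nww' : ~~ w -- w' by have := set22 w w'; rewrite -cls_w inE.
  have /codomP[a def_w] : w \in codom f.
    by rewrite f_codom; apply: contraTneq vw => ->; rewrite adj_irr.
  have /codomP[b def_w'] : w' \in codom f.
    by rewrite f_codom; apply: contraTneq vw => <-; rewrite adj_sym.
  apply: (@nonadjacent_pathwidth _ _ a b) => //.
    by apply: contraNneq ne_w' => ab; rewrite def_w' -ab def_w.
  by rewrite fE -def_w -def_w'.
- apply: (@subgraph_pathwidth k (del_edge u v) H f) => [|a b|]; first exact: bij_inj f_bij.
    by rewrite fE.
  exact: cocktail_del_edge_pathwidth.
have H_lt := edge_contraction_card uvH; rewrite Gk ltnS in H_lt.
case: uvH => uv [f [f_onto fE adjE]].
(* The classes of [u] and [v] cover at most 4 of the [k.+3] vertices; in the 4-cycle, where [k = 1],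
   they cover everything. *)
have [w] : exists w, w \in ~: (nonneighbours u :|: nonneighbours v).
  apply/card_gt0P; rewrite -(ltn_add2l #|nonneighbours u :|: nonneighbours v|) cardsC addn0.
  apply: leq_ltn_trans (leq_card_setU _ _) _.
  by rewrite !cls2 Gk !ltnS ltnW.
have [w' ne_w' cls_w] := cocktail_mate w.
rewrite !inE negb_or !negbK => /andP[uw vw].
have nww' : ~~ w -- w' by have := set22 w w'; rewrite -cls_w inE.
have f_eq (x y : G) : u -- y -> v -- y -> f x = f y -> x = y.
  move=> uy vy /fE[//|xy].
  have : y \in [set u; v] by rewrite -xy set22.
  by move=> /set2P[] yE; [move: uy | move: vy]; rewrite yE adj_irr.
have [uw' vw'] : u -- w' /\ v -- w'.
  by move: nww' uw vw; rewrite !colP negbK => /eqP<-.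
apply: (@nonadjacent_pathwidth _ _ (f w) (f w')) => //.
  by apply: contraNneq ne_w' => /f_eq->.
apply/negP=> /adjE[_ [x [y [/f_eq-> // /f_eq-> // ww']]]].
by rewrite ww' in nww'.
Qed.

End CocktailParty.

Lemma complete_partite_pairs_minimal (k : nat) (G : sgraph) :
    3 <= k -> odd k -> is_complete_partite (fun _ : 'I_((k + 3) %/ 2) => 2) G ->
  ~ treewidth_class k G /\ forall H, proper_minor H G -> pathwidth_class k H.
Proof.
move=> k_ge3 k_odd [col colP col2].
have cls2 (x : G) : #|nonneighbours x| = 2 by rewrite (nonneighboursE colP) col2.
have Gk : #|G| = k.+3.
  rewrite -sum1_card (partition_big col predT) //=.
  rewrite (eq_bigr (fun=> 2)) => [|i _]; last first.
    by rewrite -[RHS](col2 i) -sum1_card; apply: eq_bigl => x; rewrite inE.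
  (* Oddness of [k] makes the division by 2 exact. *)
  by rewrite sum_nat_const card_ord divnK ?addn3 // dvdn2 /= !negbK.
split; first exact: cocktail_not_treewidth Gk cls2.
by move=> H; apply: proper_minor_pathwidth => G'; apply: cocktail_minor_step colP Gk cls2 _ k_ge3.
Qed.

Theorem theorem8p9 (k : nat) (hk : 1 <= k) (G : sgraph)
    (hG : complete_multipartite G) :
  (minimal_forbidden_minor (treewidth_class k) G <->
   minimal_forbidden_minor (pathwidth_class k) G) /\
  (minimal_forbidden_minor (pathwidth_class k) G <->
   (is_complete (k + 2) G \/
    [/\ 3 <= k, odd k &
        is_complete_partite (fun _ : 'I_((k + 3) %/ 2) => 2) G])).
Proof.
have [c [col colP]] := hG.
have pw_tw := @pathwidth_treewidth_class k.
pose C := is_complete (k + 2) G \/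
  [/\ 3 <= k, odd k & is_complete_partite (fun _ : 'I_((k + 3) %/ 2) => 2) G].
have minC : C -> ~ treewidth_class k G /\ forall H, proper_minor H G -> pathwidth_class k H.
  by case=> [/complete_minimal|[? ?]]; last exact: complete_partite_pairs_minimal.
have twC : minimal_forbidden_minor (treewidth_class k) G -> C.
  by case=> ntw twH; apply: (minimal_multipartite hk colP) => // /pw_tw.
have pwC : minimal_forbidden_minor (pathwidth_class k) G -> C.
  by case=> npw pwH; apply: (minimal_multipartite hk colP) => // H /pwH/pw_tw.
have Ctw : C -> minimal_forbidden_minor (treewidth_class k) G.
  by case/minC=> ntw pwH; split=> // H /pwH/pw_tw.
have Cpw : C -> minimal_forbidden_minor (pathwidth_class k) G.
  by case/minC=> ntw pwH; split=> // /pw_tw.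
by split; [split=> [/twC/Cpw|/pwC/Ctw] | split=> [/pwC|/Cpw]].
Qed.
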